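(* Let $G$ be a connected graph on $N$ vertices $V=\{1,\dots,N\}$ with fixed orthonormal Laplacian eigenbasis $\{\varphi_k\}_{k=0}^{N-1}$ and eigenvector matrix $\Phi$, and let $i\in\{1,\dots,N\}$. The graph translation operator $T_i$ fails to be invertible if and only if there exists some $k\in\{1,\dots,N-1\}$ for which $\varphi_k(i)=0$. In particular, the nullspace of $T_i$ has as a basis those eigenvectors $\varphi_k$ (of the fixed eigenbasis) that vanish on the $i$-th vertex. Additionally, $T_i$ is unitary if and only if $|\varphi_k(i)|=1/\sqrt N$ for all $k=0,1,\dots,N-1$; and all graph translation operators $T_1,\dots,T_N$ are unitary if and only if $\sqrt N\,\Phi$ is a Hadamard matrix.
   Context: All graphs are finite, undirected, unweighted and simple (no loops, no multiple edges). The Laplacian of $G$ is $L=D-A$ ($D$ the diagonal degree matrix, $A$ the adjacency matrix), i.e. $Lf(x)=\sum_{y\sim x}(f(x)-f(y))$. Its eigenvalues are $0=\lambda_0\le\lambda_1\le\cdots\le\lambda_{N-1}$, and one fixes an orthonormal basis of (real- or complex-valued) eigenvectors $\varphi_0,\dots,\varphi_{N-1}$ with $L\varphi_k=\lambda_k\varphi_k$ and $\varphi_0\equiv 1/\sqrt N$; $\Phi$ is the $N\times N$ matrix with these as columns. The graph Fourier transform of $f:V\to\mathbb{C}$ is $\hat f(\lambda_k)=\langle f,\varphi_k\rangle=\sum_{n=1}^N f(n)\varphi_k^*(n)$, where $^*$ denotes complex conjugation and the value is indexed by $k$. For $i\in\{1,\dots,N\}$, the graph translation operator $T_i:\mathbb{C}^N\to\mathbb{C}^N$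 is $(T_if)(n)=\sqrt N\sum_{k=0}^{N-1}\hat f(\lambda_k)\varphi_k^*(i)\varphi_k(n)$. A (possibly complex) Hadamard matrix of order $N$ is an $N\times N$ matrix $H$ all of whose entries have absolute value $1$ and with $HH^*=NI$. *)

(* Defs.v *)
From HB Require Import structures.
From mathcomp Require Import all_boot all_order all_algebra.
From mathcomp Require Import complex reals.
From mathcomp Require Import sesquilinear spectral.

Set Implicit Arguments.
Unset Strict Implicit.
Unset Printing Implicit Defensive.

Import Order.TTheory GRing.Theory Num.Theory.
Local Open Scope sesquilinear_scope.
Local Open Scope complex_scope.
Local Open Scope ring_scope.

Section Graph.
Variables (R : realType) (N : nat).

Definition simple_graph (e : rel 'I_N) : Prop := symmetric e /\ irreflexive e.

Definition connected_graph (e : rel 'I_N) : Prop := forall x y, connect e x y.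

Definition degree_mx (e : rel 'I_N) : 'M[R[i]]_N :=
  diag_mx (\row_x #|[set y | e x y]|%:R).

Definition adjacency_mx (e : rel 'I_N) : 'M[R[i]]_N :=
  \matrix_(x, y) (e x y)%:R.

Definition laplacian (e : rel 'I_N) : 'M[R[i]]_N :=
  degree_mx e - adjacency_mx e.

Definition inner (f g : 'cV[R[i]]_N) : R[i] :=
  \sum_(n < N) f n 0 * (g n 0)^*.

(* Since the phi k are N orthonormal vectors in dimension N, the lam k are all
   the eigenvalues of the Laplacian, repeated according to multiplicity. *)
Record laplacian_eigenbasis (e : rel 'I_N) (lam : 'I_N -> R)
    (phi : 'I_N -> 'cV[R[i]]_N) : Prop := LaplacianEigenbasis {
  eigenbasis_eigen : forall k, laplacian e *m phi k = (lam k)%:C *: phi k;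
  eigenbasis_orthonormal : forall j k, inner (phi j) (phi k) = (j == k)%:R;
  eigenbasis_sorted : forall j k : 'I_N, (j <= k)%N -> lam j <= lam k;
  eigenbasis_lam0 : forall k : 'I_N, k = 0%N :> nat -> lam k = 0;
  eigenbasis_phi0 : forall k : 'I_N, k = 0%N :> nat ->
    phi k = const_mx (sqrtC N%:R)^-1
}.

Definition eigenvector_mx (phi : 'I_N -> 'cV[R[i]]_N) : 'M[R[i]]_N :=
  \matrix_(n, k) phi k n 0.

Definition fourier (phi : 'I_N -> 'cV[R[i]]_N) (f : 'cV[R[i]]_N) (k : 'I_N) :
    R[i] := inner f (phi k).

Definition translation (phi : 'I_N -> 'cV[R[i]]_N) (i : 'I_N)
    (f : 'cV[R[i]]_N) : 'cV[R[i]]_N :=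
  \col_n (sqrtC N%:R * \sum_(k < N) fourier phi f k * (phi k i 0)^* * phi k n 0).

Lemma translation_is_linear phi i : linear (translation phi i).
Proof.
move=> a f g; apply/colP => n; rewrite !mxE.
rewrite mulrCA -mulrDr; congr (_ * _); rewrite mulr_sumr -big_split /=.
apply: eq_bigr => k _; rewrite !mulrA -!mulrDl; congr (_ * _ * _).
rewrite /fourier /inner mulr_sumr -big_split /=.
by apply: eq_bigr => m _; rewrite !mxE mulrDl mulrA.
Qed.

HB.instance Definition _ phi i :=
  GRing.isLinear.Build R[i] 'cV[R[i]]_N 'cV[R[i]]_N *:%R (translation phi i)
    (translation_is_linear phi i).

(* Matrix of T in the standard basis; it represents T only when T is linear. *)
Definition operator_mx (T : 'cV[R[i]]_N -> 'cV[R[i]]_N) : 'M[R[i]]_N :=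
  \matrix_(m, n) T (delta_mx n 0) m 0.

Lemma mul_operator_mx (T : {linear 'cV[R[i]]_N -> 'cV[R[i]]_N}) f :
  operator_mx T *m f = T f.
Proof.
apply/colP => m; rewrite mxE [in RHS](matrix_sum_delta f).
under [in RHS]eq_bigr do rewrite big_ord1.
rewrite linear_sum summxE; apply: eq_bigr => n _.
by rewrite linearZ !mxE mulrC.
Qed.

Definition unitary_operator (T : 'cV[R[i]]_N -> 'cV[R[i]]_N) : Prop :=
  operator_mx T \is unitarymx.

Definition hadamard (H : 'M[R[i]]_N) : Prop :=
  (forall j k, `|H j k| = 1) /\ H *m H^t* = N%:R%:M.

End Graph.

(* Main.v *)
Require Import Defs.
From mathcomp Require Import all_boot all_order all_algebra.
From mathcomp Require Import complex reals.
From mathcomp Require Import sesquilinear spectral.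

Set Implicit Arguments.
Unset Strict Implicit.
Unset Printing Implicit Defensive.

Import Order.TTheory GRing.Theory Num.Theory.
Local Open Scope complex_scope.
Local Open Scope ring_scope.

(** A translation operator is a Fourier multiplier: the eigenbasis diagonalizes
    [T_i], and [T_i phi_k = c_k phi_k] with [c_k = sqrt N * conj (phi_k i)].
    Since [Phi] is unitary, every assertion is a statement about the numbers
    [c_k].  The kernel of [T_i] is spanned by the [phi_k] with [c_k = 0], that
    is, those vanishing at [i]; as a linear endomorphism in finite dimension,
    [T_i] is bijective exactly when there are none of these, and [phi_0] is never one,
    being a nonzero constant.  Moreover [T_i] is unitarily similar to the
    diagonal matrix of the [c_k], hence unitary iff [`|c_k| = 1] for all [k].
    Letting [i] vary, this says that all entries of [sqrt N Phi] have modulus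
    [1], and the remaining Hadamard condition is the unitarity of [Phi]. *)

Section OrthonormalTranslation.
Local Open Scope sesquilinear_scope.
Variables (R : realType) (N : nat) (phi : 'I_N -> 'cV[R[i]]_N).
Hypothesis phi_orthonormal : forall j k, inner (phi j) (phi k) = (j == k)%:R.

Definition translation_eigenvalue (i k : 'I_N) : R[i] :=
  sqrtC N%:R * (phi k i 0)^*.

Lemma translationE i f :
  translation phi i f =
  \sum_k (fourier phi f k * translation_eigenvalue i k) *: phi k.
Proof.
apply/colP => n; rewrite mxE summxE mulr_sumr; apply: eq_bigr => k _.
by rewrite mxE /translation_eigenvalue !mulrA [sqrtC _ * _]mulrC.
Qed.

Lemma translation_eigenvector i k :
  translation phi i (phi k) = translation_eigenvalue i k *: phi k.
Proof.
rewrite translationE (bigD1 k) //= big1 ?addr0 => [|j neq_jk].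
  by rewrite /fourier phi_orthonormal eqxx mul1r.
by rewrite /fourier phi_orthonormal eq_sym (negPf neq_jk) mul0r scale0r.
Qed.

Lemma fourierE f k : fourier phi f k = ((eigenvector_mx phi)^t* *m f) k 0.
Proof. by rewrite mxE; apply: eq_bigr => n _; rewrite !mxE mulrC. Qed.

(** Orthonormality says that the columns of the matrix are orthonormal; the
    rows are then orthonormal too because the matrix is square. *)
Lemma eigenvector_mx_unitary : eigenvector_mx phi \is unitarymx.
Proof.
apply/unitarymxP/mulmx1C/matrixP => j k.
rewrite !mxE eq_sym -phi_orthonormal; apply: eq_bigr => n _.
by rewrite !mxE mulrC.
Qed.

Lemma fourier_expansion f : f = \sum_k fourier phi f k *: phi k.
Proof.
rewrite -[LHS]mul1mx -(unitarymxP eigenvector_mx_unitary) -mulmxA.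
apply/colP => n; rewrite mxE summxE; apply: eq_bigr => k _.
by rewrite -fourierE !mxE mulrC.
Qed.

Lemma operator_mx_translation i :
  operator_mx (translation phi i) =
  eigenvector_mx phi *m diag_mx (\row_k translation_eigenvalue i k)
    *m (eigenvector_mx phi)^t*.
Proof.
apply/matrixP => m n; rewrite mxE translationE summxE [RHS]mxE.
apply: eq_bigr => k _; rewrite mul_mx_diag fourierE !mxE.
rewrite (bigD1 n) //= big1 ?addr0 => [|j neq_jn]; last first.
  by rewrite !mxE (negPf neq_jn) mulr0.
by rewrite !mxE !eqxx mulr1 -mulrA mulrC; congr (_ * _); apply: mulrC.
Qed.

Lemma fourier_translation i f k :
  fourier phi (translation phi i f) k =
  translation_eigenvalue i k * fourier phi f k.
Proof.
have PtP := mulmx1C (unitarymxP eigenvector_mx_unitary).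
rewrite !fourierE -(mul_operator_mx (translation phi i)).
rewrite operator_mx_translation !mulmxA PtP mul1mx.
by rewrite -mulmxA mul_diag_mx !mxE.
Qed.

(** The family spans by the Fourier expansion, and has only [N] members. *)
Lemma orthonormal_basis : basis_of fullv [seq phi k | k <- enum 'I_N].
Proof.
rewrite basisEdim size_map size_enum_ord dimvf /dim /= muln1 leqnn andbT.
apply/subvP => f _; rewrite [f]fourier_expansion; apply: memv_suml => k _.
by rewrite memvZ // memv_span // map_f ?mem_enum.
Qed.

Lemma eigenvector_neq0 k : phi k != 0.
Proof.
by apply: free_not0 (basis_free orthonormal_basis) _; rewrite map_f ?mem_enum.
Qed.

Lemma translation_eigenvalue_eq0 i k :
  (translation_eigenvalue i k == 0) = (phi k i 0 == 0).
Proof.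
rewrite mulf_eq0 sqrtC_eq0 pnatr_eq0 conjC_eq0.
by rewrite -[N == 0%N]negbK -lt0n (leq_ltn_trans _ (ltn_ord i)).
Qed.

(** Since [T_i] multiplies the [k]-th Fourier coefficient by the [k]-th
    eigenvalue, the Fourier expansion of a kernel vector only involves the
    eigenvectors of eigenvalue zero; freeness is inherited from the whole
    basis. *)
Lemma translation_kernel_basis i :
  basis_of (lker (linfun (translation phi i)))
    [seq phi k | k <- enum 'I_N & phi k i 0 == 0].
Proof.
apply/andP; split; last first.
  have := filter_free [pred v : 'cV_N | v i 0 == 0] (basis_free orthonormal_basis).
  by rewrite filter_map.
rewrite eqEsubv; apply/andP; split.
  apply/span_subvP => _ /mapP[k + ->]; rewrite mem_filter => /andP[phik0 _].
  rewrite memv_ker lfunE /= translation_eigenvector.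
  by move: phik0; rewrite -translation_eigenvalue_eq0 => /eqP->; rewrite scale0r.
apply/subvP => f; rewrite memv_ker lfunE /= => /eqP Tf0.
rewrite [f]fourier_expansion; apply: memv_suml => k _.
have [phik0|phik0] := boolP (phi k i 0 == 0).
  by rewrite memvZ // memv_span // map_f // mem_filter phik0 mem_enum.
suff -> : fourier phi f k = 0 by rewrite scale0r mem0v.
apply/eqP; have /eqP : fourier phi (translation phi i f) k = 0.
  by rewrite Tf0 fourierE mulmx0 mxE.
rewrite fourier_translation mulf_eq0 translation_eigenvalue_eq0.
by rewrite (negPf phik0).
Qed.

(** In finite dimension an injective endomorphism is bijective, so only the
    kernel matters. *)
Lemma bijective_translation i :
  bijective (translation phi i) <-> (forall k, phi k i 0 != 0).
Proof.
split=> [/bij_inj T_inj k | phi_neq0].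
  apply: contra (eigenvector_neq0 k) => phik0; apply/eqP/T_inj.
  rewrite translation_eigenvector linear0; move: phik0.
  by rewrite -translation_eigenvalue_eq0 => /eqP->; rewrite scale0r.
have ker0 : lker (linfun (translation phi i)) == 0%VS.
  rewrite -(span_basis (translation_kernel_basis i)).
  rewrite (eq_filter (a2 := pred0)) ?filter_pred0 /= ?span_nil // => k.
  exact: negPf.
have T_bij : bijective (linfun (translation phi i)).
  by exists (linfun (translation phi i))^-1%VF;
    [exact: lker0_lfunK | exact: lker0_lfunVK].
exact: (eq_bij T_bij (lfunE _)).
Qed.

Lemma norm_sqrt_order_mul (i : 'I_N) (z : R[i]) :
  `|sqrtC N%:R * z| = 1 <-> `|z| = (sqrtC N%:R)^-1.
Proof.
have N_gt0 : 0 < sqrtC N%:R :> R[i].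
  by rewrite sqrtC_gt0 ltr0n (leq_ltn_trans _ (ltn_ord i)).
rewrite normrM gtr0_norm //.
split=> [/(canRL (mulKf (lt0r_neq0 N_gt0))) -> | ->].
  by rewrite mulr1.
by rewrite divff ?lt0r_neq0.
Qed.

Lemma diag_mx_unitary (d : 'rV[R[i]]_N) :
  diag_mx d \is unitarymx <-> (forall k, `|d 0 k| = 1).
Proof.
have -> : (diag_mx d \is unitarymx) =
          (diag_mx (\row_k (`|d 0 k| ^+ 2)) == 1%:M).
  rewrite qualifE /=; congr (_ == _); rewrite tr_diag_mx map_diag_mx mulmx_diag.
  by congr diag_mx; apply/rowP => k; rewrite !mxE normCK.
split=> [/eqP/matrixP d1 k | d1].
  by apply/eqP; have := d1 k k; rewrite !mxE eqxx mulr1n => /eqP; rewrite sqrp_eq1.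
apply/eqP/matrixP => j k; rewrite !mxE d1 expr1n.
by case: eqP.
Qed.

(** Unitary similarity preserves unitarity in both directions. *)
Lemma unitary_translation i :
  unitary_operator (translation phi i) <->
  (forall k, `|phi k i 0| = (sqrtC N%:R)^-1).
Proof.
set d := \row_k translation_eigenvalue i k.
have normd k : (`|d 0 k| = 1) <-> (`|phi k i 0| = (sqrtC N%:R)^-1).
  by rewrite mxE norm_sqrt_order_mul // norm_conjC.
have -> : unitary_operator (translation phi i) <-> diag_mx d \is unitarymx.
  have P_unitary := eigenvector_mx_unitary.
  have Pt_unitary : (eigenvector_mx phi)^t* \is unitarymx.
    by rewrite trmxC_unitary.
  rewrite /unitary_operator operator_mx_translation -/d.
  split=> [T_unitary | d_unitary]; last by rewrite !mul_unitarymx.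
  have := mul_unitarymx (mul_unitarymx Pt_unitary T_unitary) P_unitary.
  have PtP := mulmx1C (unitarymxP P_unitary).
  by rewrite !mulmxA PtP mul1mx -mulmxA PtP mulmx1.
rewrite diag_mx_unitary.
by split=> d1 k; apply/normd.
Qed.

(** The rows of a unitary matrix scaled by [sqrt N] always satisfy
    [H H^* = N I], so only the modulus condition is at stake. *)
Lemma hadamard_eigenvector_mx :
  hadamard (sqrtC N%:R *: eigenvector_mx phi) <->
  (forall j k, `|phi k j 0| = (sqrtC N%:R)^-1).
Proof.
have norm_entry (j k : 'I_N) :
    (`|(sqrtC N%:R *: eigenvector_mx phi) j k| = 1) <->
    (`|phi k j 0| = (sqrtC N%:R)^-1).
  by rewrite !mxE norm_sqrt_order_mul.
split=> [[H1 _] j k | H1]; first exact/norm_entry.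
split=> [j k|]; first exact/norm_entry.
rewrite linearZ map_mxZ -scalemxAl -scalemxAr scalerA.
rewrite (unitarymxP eigenvector_mx_unitary) scalemx1 -normCK ger0_norm.
  by rewrite sqrtCK.
by rewrite sqrtC_ge0 ler0n.
Qed.

End OrthonormalTranslation.

Theorem theorem2p5 (R : realType) (N : nat) (e : rel 'I_N) (lam : 'I_N -> R)
    (phi : 'I_N -> 'cV[R[i]]_N) (i : 'I_N)
    (e_simple : simple_graph e) (e_connected : connected_graph e)
    (phi_eigenbasis : laplacian_eigenbasis e lam phi) :
  [/\ ~ bijective (translation phi i) <->
        (exists k : 'I_N, (0 < k)%N /\ phi k i 0 = 0),
      basis_of (lker (linfun (translation phi i)))
        [seq phi k | k <- enum 'I_N & phi k i 0 == 0],
      unitary_operator (translation phi i) <->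
        (forall k : 'I_N, `|phi k i 0| = (sqrtC N%:R)^-1)
    & (forall j : 'I_N, unitary_operator (translation phi j)) <->
        hadamard (sqrtC N%:R *: eigenvector_mx phi)].
Proof.
have phi_on := eigenbasis_orthonormal phi_eigenbasis.
have phi0_neq0 (k : 'I_N) : k = 0%N :> nat -> phi k i 0 != 0.
  move=> k0; rewrite (eigenbasis_phi0 phi_eigenbasis k0) mxE invr_eq0.
  by rewrite sqrtC_eq0 pnatr_eq0 -lt0n (leq_ltn_trans _ (ltn_ord i)).
split.
- rewrite bijective_translation //.
  split=> [not_all | [k [_ phik0]] /(_ k)].
    have /existsP[k /eqP phik0] : [exists k, phi k i 0 == 0].
      apply: contra_notT not_all; rewrite negb_exists => /forallP; exact.
    exists k; split=> //; rewrite lt0n.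
    by apply: contra_eqN phik0 => /eqP; apply: phi0_neq0.
  by rewrite phik0 eqxx.
- exact: translation_kernel_basis.
- exact: unitary_translation.
- rewrite hadamard_eigenvector_mx //.
  by split=> unit_j j; apply/unitary_translation.
Qed.
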